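(* Let $G$ be a finite rectangular grid with toroidal boundary conditions and consider $6$-colourings of $G$. Let $\Theta=\{\Theta_1,\dots,\Theta_m\}$ be a cover of the vertex set of $G$ by blocks, and for every block $\Theta_k$, every vertex $i$ and every pair $(\sigma,\tau)\in S_i$ let $\Psi_k(\sigma,\tau)$ be an arbitrary coupling of the heat-bath distributions $\pi_k(\sigma)$ and $\pi_k(\tau)$. Then the influence parameter $\alpha=\max_{k}\max_{j\in\Theta_k}\sum_i\rho_{i,j}^k$ satisfies: (i) $\alpha\ge 1.286>1$ if all blocks are $2\times2$ sub-grids; (ii) $\alpha\ge 1.028>1$ if all blocks are $2\times3$ sub-grids; (iii) $\alpha\ge 1.0148>1$ if all blocks are $3\times3$ sub-grids.
   Context: Grid: $G$ has vertex set $V=\mathbb{Z}_a\times\mathbb{Z}_b$ with $a,b\ge5$, and $(x,y)$ is adjacent to $(x\pm1,y)$ and $(x,y\pm1)$ (coordinates mod $a$ and mod $b$). An $r\times s$ sub-grid is a set of the form $\{x,\dots,x+r-1\}\times\{y,\dots,y+s-1\}$. $\Omega^{+}$ is the set of all functions $V\to\{1,\dots,6\}$ (colourings, not necessarily proper). $S_i$ is the set of pairs $(\sigma,\tau)\in\Omega^{+}\times\Omega^{+}$ with $\sigma_l=\tau_l$ for all $l\ne i$. $\partial\Theta_k$ is the set of vertices in $V\setminus\Theta_k$ adjacent to some vertex of $\Theta_k$. Heat-bath distribution: for $\sigma\in\Omega^{+}$, $\pi_k(\sigma)$ is the uniform distribution on the set of $\sigma'\in\Omega^{+}$ such that $\sigma'=\sigma$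 on $V\setminus\Theta_k$, adjacent vertices inside $\Theta_k$ get different colours under $\sigma'$, and each $j\in\Theta_k$ has $\sigma'_j$ different from the colours under $\sigma$ of all vertices of $\partial\Theta_k$ adjacent to $j$. Influence: $p_j(\Psi_k(\sigma,\tau))$ is the probability that vertex $j$ has different colours in the pair of colourings drawn from $\Psi_k(\sigma,\tau)$, and $\rho_{i,j}^k=\max_{(\sigma,\tau)\in S_i}p_j(\Psi_k(\sigma,\tau))$. *)

(* Defs.v *)
From mathcomp Require Export all_boot all_order all_algebra.
From mathcomp Require Export reals.

Set Implicit Arguments.
Unset Strict Implicit.
Unset Printing Implicit Defensive.

Import Order.TTheory GRing.Theory Num.Theory.
Local Open Scope ring_scope.

(* 'Z_a is the ring of integers mod a only for a > 1; the grids considered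
   have a, b >= 5. *)
Notation vertex a b := ('Z_a * 'Z_b)%type.

Definition adj (a b : nat) : rel (vertex a b) :=
  fun u v =>
    [|| v == (u.1 + 1, u.2), v == (u.1 - 1, u.2),
        v == (u.1, u.2 + 1) | v == (u.1, u.2 - 1)].

Definition is_subgrid (r s a b : nat) (A : {set vertex a b}) : Prop :=
  exists (x : 'Z_a) (y : 'Z_b),
    A = [set (x + p%:R, y + q%:R) | p : 'I_r, q : 'I_s].

(* All colourings with six colours, proper or not. *)
Notation colouring a b := {ffun vertex a b -> 'I_6}.

(* Pairs of colourings that agree everywhere except possibly at i. *)
Definition agree_off (a b : nat) (i : vertex a b) :
    {set colouring a b * colouring a b} :=
  [set st : colouring a b * colouring a b |
    [forall l, (l != i) ==> (st.1 l == st.2 l)]].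

Definition boundary (a b : nat) (B : {set vertex a b}) : {set vertex a b} :=
  [set v in ~: B | [exists u in B, adj v u]].

Definition heat_bath_support (a b : nat) (B : {set vertex a b})
    (sigma : colouring a b) : {set colouring a b} :=
  [set sigma' : colouring a b |
    [&& [forall v in ~: B, sigma' v == sigma v],
        [forall u in B, forall v in B, adj u v ==> (sigma' u != sigma' v)]
      & [forall j in B, forall l in boundary B,
           adj j l ==> (sigma' j != sigma l)]]].

Definition heat_bath (R : realType) (a b : nat) (B : {set vertex a b})
    (sigma : colouring a b) : colouring a b -> R :=
  fun sigma' =>
    if sigma' \in heat_bath_support B sigma
    then (#|heat_bath_support B sigma|%:R)^-1 else 0.

(* Distributions on a finite type are given by their mass functions. *)
Definition is_distribution (R : realType) (T : finType) (mu : T -> R) : Prop :=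
  (forall x, 0 <= mu x) /\ \sum_x mu x = 1.

Definition is_coupling (R : realType) (T : finType) (p q : T -> R)
    (mu : T * T -> R) : Prop :=
  [/\ is_distribution mu,
      forall x, \sum_y mu (x, y) = p x
    & forall y, \sum_x mu (x, y) = q y].

Definition prob_differ (R : realType) (a b : nat) (j : vertex a b)
    (mu : colouring a b * colouring a b -> R) : R :=
  \sum_(w : colouring a b * colouring a b | w.1 j != w.2 j) mu w.

(* Only the values of Psi on the pairs of [agree_off i] matter.  There Psi
   consists of couplings, so the quantities maximised here and in [influence]
   are nonnegative; with nonempty blocks the maxima are over nonempty index
   sets, so the default value 0 of the iterated maximum is harmless. *)
Definition rho (R : realType) (a b : nat)
    (Psi : colouring a b -> colouring a b -> colouring a b * colouring a b -> R)
    (i j : vertex a b) : R :=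
  \big[Order.max/0]_(st in agree_off i) prob_differ j (Psi st.1 st.2).

Definition influence (R : realType) (a b m : nat)
    (Theta : 'I_m -> {set vertex a b})
    (Psi : 'I_m -> colouring a b -> colouring a b ->
           colouring a b * colouring a b -> R) : R :=
  \big[Order.max/0]_(k < m) \big[Order.max/0]_(j in Theta k)
    \sum_i rho (Psi k) i j.

(* Main.v *)
(** The lower bound holds at the corner [j] of any block.  For every boundary
    vertex [i] used, an explicit colouring [sigma] of the boundary and a
    recolouring [tau] of it at [i] are given, together with a set [C] of
    colours ("hot" below); every coupling satisfies
      [P(sigma'_j <> tau'_j) >= P(sigma'_j \in C) - P(tau'_j \in C)],
    and the right-hand side only involves numbers of proper colourings of the
    block.  These are computed by a transfer-matrix recursion that colours the
    block in raster order and remembers the last [s] colours, [s] being the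
    number of columns. *)

From Stdlib Require Import NArith.
From mathcomp Require Import zify ring lra.
Require Import Defs.

Set Implicit Arguments.
Unset Strict Implicit.
Unset Printing Implicit Defensive.

Import Order.TTheory GRing.Theory Num.Theory.
Local Open Scope ring_scope.

(** * Counting by a transfer recursion *)

(** A function on words over [q] letters is stored as a tree of its values, so that under
    [vm_compute] each value is computed once and then looked up. *)
Inductive trie := Leaf of N | Node of seq trie.

Fixpoint memo (q d : nat) (F : seq nat -> N) : trie :=
  if d is d'.+1 then Node [seq memo q d' (fun h => F (c :: h)) | c <- iota 0 q]
  else Leaf (F [::]).

(** A leaf ignores the rest of the word: looking up a long history cuts it to the depth of the
    tree. *)
Fixpoint lookup (t : trie) (h : seq nat) : N :=
  match t, h with
  | Leaf n, _ => n
  | Node ts, c :: h' => lookup (nth (Leaf 0%num) ts c) h'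
  | Node _, [::] => 0%num
  end.

Arguments lookup : simpl nomatch.

Definition sumN (s : seq N) : N := foldr N.add 0%num s.

(** Colours are chosen for the cells [k], [k+1], ..., [k+n-1]; [bad l h] lists
    the colours forbidden at cell [l] after the history [h], most recent colour
    first.  The entry at [h] counts the choices.  The history is cut at length
    [s], so each count is computed once per frontier instead of once per
    colouring. *)
Fixpoint table (q s : nat) (bad : nat -> seq nat -> seq nat) (n k : nat) : trie :=
  if n is n'.+1 then
    let t := table q s bad n' k.+1 in
    memo q (minn k s) (fun h => let b := bad k h in
      sumN [seq if c \in b then 0%num else lookup t (c :: h) | c <- iota 0 q])
  else memo q (minn k s) (fun=> 1%num).

(** [M] gives the colours outside the block [1..r] x [1..s]; the last line
    restricts the corner cell to [hot]. *)
Definition grid_bad (r s : nat) (M : nat -> nat -> nat) (hot : seq nat)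
    (k : nat) (h : seq nat) : seq nat :=
  let p := (k %/ s).+1 in let q := (k %% s).+1 in
  (if p == 1%N then M 0%N q else nth 0%N h s.-1)
  :: (if q == 1%N then M p 0%N else nth 0%N h 0)
  :: (if p == r then [:: M r.+1 q] else [::])
  ++ (if q == s then [:: M p s.+1] else [::])
  ++ (if k == 0%N then [seq c <- iota 0 6 | c \notin hot] else [::]).

Definition grid_count r s M hot : N :=
  lookup (table 6 s (grid_bad r s M hot) (r * s) 0) [::].

(** [wgrid] is the window [0..r+1] x [0..s+1]; its entries in the block and at
    the four corners are irrelevant.  The disagreement is at ([wrow], [wcol]),
    where the second colouring has colour 1, and [wbound] is a lower bound for
    the influence on the cell (1, 1), in millionths. *)
Record witness := Witness
  { wrow : nat; wcol : nat; whot : seq nat; wbound : N; wgrid : seq (seq nat) }.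

Definition wcolour (w : witness) (p q : nat) : nat := nth 0%N (nth [::] (wgrid w) p) q.

Definition wcolour' (w : witness) (p q : nat) : nat :=
  if (p == wrow w) && (q == wcol w) then 1%N else wcolour w p q.

(** One size serves both dimensions, since only square windows are transposed. *)
Definition wtranspose (w : witness) : witness :=
  Witness (wcol w) (wrow w) (whot w) (wbound w)
    (mkseq (fun q => mkseq (fun p => wcolour w p q) (size (wgrid w))) (size (wgrid w))).

(** This is m/n - m'/n' >= [wbound] / 10^6 with the positive denominators cleared, so that it is
    decided in [N]. *)
Definition wcheck r s (w : witness) : bool :=
  let n := grid_count r s (wcolour w) (iota 0 6) in
  let m := grid_count r s (wcolour w) (whot w) in
  let n' := grid_count r s (wcolour' w) (iota 0 6) in
  let m' := grid_count r s (wcolour' w) (whot w) in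
  [&& N.ltb 0 n, N.ltb 0 n' &
   N.leb (wbound w * (n * n') + 1000000 * (m' * n)) (1000000 * (m * n'))]%num.

Definition in_window r s (w : witness) : bool :=
  [&& (wrow w < r.+2)%N, (wcol w < s.+2)%N & all (all (gtn 6)) (wgrid w)].

(** Distinct positions make the bounds apply to distinct terms of the sum over i. *)
Definition certificate r s (ws : seq witness) (t : N) : bool :=
  [&& uniq [seq (wrow w, wcol w) | w <- ws], all (in_window r s) ws,
      all (wcheck r s) ws & N.leb t (sumN [seq wbound w | w <- ws])].

Lemma lookup_memo q d F h :
  (d <= size h)%N -> all (gtn q) h -> lookup (memo q d F) h = F (take d h).
Proof.
elim: d F h => [|d IHd] F [|c h] //= szh /andP[cq hq].
by rewrite (nth_map 0%N) ?size_iota // nth_iota // add0n IHd.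
Qed.

Lemma to_nat_sumN (s : seq N) : N.to_nat (sumN s) = sumn (map N.to_nat s).
Proof. by elim: s => //= x s <-; rewrite Nnat.N2Nat.inj_add. Qed.

(** * Correctness of the transfer recursion *)

Section Transfer.

Variables (V : finType) (q s K : nat) (f : nat -> V).
Variable bad : nat -> seq nat -> seq nat.
Hypothesis f_inj : {in gtn K &, injective f}.
Hypothesis bad_take : forall k h, bad k (take s h) = bad k h.

Fixpoint hist (g : {ffun V -> 'I_q}) (k : nat) : seq nat :=
  if k is k'.+1 then val (g (f k')) :: hist g k' else [::].

(** [g0] carries both the fixed outside and the colours already chosen before cell [k]; it is the
    state of the recursion. *)
Definition extensions (g0 : {ffun V -> 'I_q}) (k n : nat) : {set {ffun V -> 'I_q}} :=
  [set g : {ffun V -> 'I_q} |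
     [forall v, (v \in [seq f l | l <- iota k n]) || (g v == g0 v)] &&
     all (fun l => val (g (f l)) \notin bad l (hist g l)) (iota k n)].

Lemma size_hist g k : size (hist g k) = k.
Proof. by elim: k => //= k ->. Qed.

Lemma all_hist g k : all (gtn q) (hist g k).
Proof. by elim: k => //= k ->; rewrite andbT; exact: ltn_ord. Qed.

Lemma nth_hist (g : {ffun V -> 'I_q}) k i :
  (i < k)%N -> nth 0%N (hist g k) i = val (g (f (k.-1 - i)%N)).
Proof.
elim: k i => [|k IHk] [|i] //=; rewrite ?subn0 // ltnS => ik.
by rewrite IHk // subnS -predn_sub.
Qed.

Lemma eq_hist (g g' : {ffun V -> 'I_q}) k :
  (forall l, (l < k)%N -> g (f l) = g' (f l)) -> hist g k = hist g' k.
Proof.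
elim: k => //= k IHk gg'; rewrite gg' // IHk // => l lk.
by apply: gg'; apply: ltnW.
Qed.

Let upd (g0 : {ffun V -> 'I_q}) (v : V) (c : 'I_q) :=
  [ffun u => if u == v then c else g0 u].

Lemma mem_window k n l :
  (k + n <= K)%N -> (l < K)%N ->
  (f l \in [seq f i | i <- iota k n]) = (k <= l < k + n)%N.
Proof.
move=> knK lK; apply/mapP/idP => [[i]|lkn]; last by exists l; rewrite ?mem_iota.
rewrite mem_iota => ikn /f_inj -> //; rewrite inE.
by case/andP: ikn => _ /leq_trans; apply.
Qed.

(** Fixing the colour at cell [k] amounts to writing it into the reference colouring. By injectivity
    of [f] the earlier cells lie outside the window, so [g] and [g0] have the same history. *)
Lemma extensions_step g0 k n (g : {ffun V -> 'I_q}) c : (k + n.+1 <= K)%N ->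
  (g \in extensions g0 k n.+1) && (g (f k) == c) =
  (val c \notin bad k (hist g0 k)) &&
  (g \in extensions (upd g0 (f k) c) k.+1 n).
Proof.
move=> knK; have kK : (k < K)%N by apply: leq_trans knK; rewrite -addSnnS leq_addr.
have kn: (k.+1 + n <= K)%N by rewrite addSnnS.
have old l : (l < k)%N -> f l \notin [seq f i | i <- iota k n.+1].
  by move=> lk; rewrite mem_window ?(ltn_trans lk kK) // leqNgt lk.
rewrite !inE /=; apply/andP/and3P => [[/and3P[/forallP gg0 gbad ->] /eqP gc]|].
  have gg0k : hist g k = hist g0 k.
    by apply: eq_hist => l /old; have /orP[-> //|/eqP ->] := gg0 (f l).
  split=> //; first by rewrite -gc -gg0k.
  apply/forallP => v; have := gg0 v; rewrite /= inE ffunE.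
  by case: eqP => [->|_]; rewrite ?gc ?eqxx ?orbT.
case=> cbad /forallP gg0 ->; rewrite andbT.
have gc : g (f k) = c.
  by have := gg0 (f k); rewrite mem_window // ltnn /= ffunE eqxx => /eqP.
have agree v : (v \in [seq f i | i <- iota k n.+1]) || (g v == g0 v).
  have := gg0 v; rewrite /= inE ffunE.
  by case: (v =P f k) => //= _ /orP[->|->]; rewrite ?orbT.
split; last by rewrite gc.
apply/andP; split; first exact/forallP.
rewrite gc; rewrite (eq_hist (g' := g0)) // => l /old.
by have /orP[-> //|/eqP ->] := agree (f l).
Qed.

(** Truncation loses nothing: [bad] reads at most [s] entries, and the next table has depth at most
    [s], so it cannot tell [c :: take s h] from [c :: h]. *)
Lemma lookup_table n k h : size h = k -> all (gtn q) h ->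
  lookup (table q s bad n k) h =
  if n is n'.+1 then
    sumN [seq if c \in bad k h then 0%num
              else lookup (table q s bad n' k.+1) (c :: h) | c <- iota 0 q]
  else 1%num.
Proof.
move=> szh hq; case: n => [|n] /=.
  by rewrite lookup_memo // szh geq_minl.
rewrite lookup_memo ?szh ?geq_minl //.
have htake: take (minn k s) h = take s h.
  case: (leqP k s) => // ks; by rewrite !take_oversize ?szh.
rewrite htake bad_take; congr sumN; apply/eq_in_map => c.
rewrite mem_iota add0n /= => cq; case: ifP => // _.
have lookup_take : lookup (table q s bad n k.+1) (c :: take s h) =
                   lookup (table q s bad n k.+1) (c :: h).
  have hq' : all (gtn q) (take s h).
    by apply/allP => x /mem_take; apply: (allP hq).
  have sz' : (minn k.+1 s <= size (c :: take s h))%N.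
    rewrite /= size_take_min szh.
    by case: (leqP s k) => _; rewrite ?geq_minl // (leq_trans (geq_minr _ _)).
  have sz : (minn k.+1 s <= size (c :: h))%N by rewrite /= szh geq_minl.
  have cc h' : all (gtn q) h' -> all (gtn q) (c :: h') by move=> /= ->; rewrite andbT.
  have same : take (minn k.+1 s) (c :: take s h) = take (minn k.+1 s) (c :: h).
    case: (minn k.+1 s) (geq_minr k.+1 s) => //= d ds.
    by rewrite take_takel // ltnW.
  have [F ->] : exists F, table q s bad n k.+1 = memo q (minn k.+1 s) F.
    by case: (n) => [|n']; eexists.
  by rewrite !lookup_memo ?cc ?same.
exact: lookup_take.
Qed.

(** Induction on [n], splitting the colourings by the colour of cell [k]. *)
Lemma card_extensions g0 k n : (k + n <= K)%N ->
  #|extensions g0 k n| = N.to_nat (lookup (table q s bad n k) (hist g0 k)).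
Proof.
elim: n k g0 => [|n IHn] k g0 knK.
  rewrite lookup_table ?size_hist ?all_hist //= -[RHS](cards1 g0).
  apply: eq_card => g; rewrite !inE /= andbT.
  by apply/forallP/eqP => [gg0|-> //]; apply/ffunP => v; apply/eqP/gg0.
rewrite lookup_table ?size_hist ?all_hist // to_nat_sumN -map_comp.
rewrite -sum1_card (partition_big (fun g : {ffun V -> 'I_q} => g (f k)) xpredT) //=.
have -> : iota 0 q = index_iota 0 q by rewrite /index_iota subn0.
rewrite sumnE big_map big_mkord.
apply: eq_bigr => c _.
rewrite (eq_bigl _ _ (fun g => @extensions_step g0 k n g c knK)) /=.
case: ifP => cbad /=; first by rewrite big_pred0.
rewrite sum1_card IHn ?addSnnS //; congr (N.to_nat (lookup _ _)).
rewrite /= ffunE eqxx; congr (_ :: _); apply: eq_hist => l lk.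
have kK : (k < K)%N by apply: leq_trans knK; rewrite -addSnnS leq_addr.
rewrite ffunE; case: eqP => // flk.
have lkE : l = k by apply: f_inj; rewrite // inE (ltn_trans lk).
by rewrite lkE ltnn in lk.
Qed.

End Transfer.

Lemma grid_bad_take r s M hot k h : (0 < s)%N ->
  grid_bad r s M hot k (take s h) = grid_bad r s M hot k h.
Proof.
by case: s => // s _; rewrite /grid_bad !nth_take.
Qed.

(** * Blocks of the torus *)

Lemma adj_sym (a b : nat) : symmetric (@adj a b).
Proof.
suff sub (u v : vertex a b) : adj u v -> adj v u by move=> u v; apply/idP/idP; apply: sub.
by case: u => x y; rewrite /adj /= => /or4P[] /eqP->; rewrite /= ?addrK ?subrK eqxx ?orbT.
Qed.

(** A neighbour outside [B] of a vertex of [B] lies in the boundary and keeps its colour, so the two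
    properness conditions merge into one. *)
Lemma heat_bath_supportP (a b : nat) (B : {set vertex a b}) (sigma g : colouring a b) :
  reflect ((forall v, v \notin B -> g v = sigma v) /\
           (forall u v, u \in B -> adj u v -> g u != g v))
          (g \in heat_bath_support B sigma).
Proof.
rewrite inE; apply: (iffP and3P) => [[/forall_inP gout /forall_inP gin /forall_inP gbd]|].
  have out v : v \notin B -> g v = sigma v by move=> vB; apply/eqP/gout; rewrite inE.
  split=> // u v uB uv; have [vB|vB] := boolP (v \in B).
    by have /forall_inP/(_ v vB)/implyP := gin u uB; apply.
  rewrite (out v) //; have /forall_inP/(_ v) := gbd u uB.
  rewrite !inE vB uv implyTb; apply; apply/exists_inP; exists u => //.
  by rewrite adj_sym.
case=> out gadj; split.
- by apply/forall_inP => v; rewrite inE => /out/eqP.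
- apply/forall_inP => u uB; apply/forall_inP => v vB; apply/implyP; exact: gadj.
apply/forall_inP => u uB; apply/forall_inP => v; rewrite !inE => /andP[vB _].
by apply/implyP => uv; rewrite -out //; apply: gadj.
Qed.

Lemma Zp_shiftK n (x : 'Z_n) p : (1 < n)%N -> (p < n)%N ->
  nat_of_ord (x + p%:R - 1 - x + 1) = p.
Proof.
by move=> n1 pn; rewrite addrAC subrK [x + _]addrC addrK val_Zp_nat // modn_small.
Qed.

Lemma Zp_unshiftK n (x y : 'Z_n) : x + (nat_of_ord (y - x + 1))%:R - 1 = y.
Proof. by rewrite natr_Zp addrA addrK addrC subrK. Qed.

(** * Coordinates around a block and its proper colourings *)

Section Window.

Variables (a b r s : nat) (x0 : 'Z_a) (y0 : 'Z_b).
Hypotheses (r_gt0 : (0 < r)%N) (s_gt0 : (0 < s)%N).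
Hypotheses (r_le : (r.+2 <= a)%N) (s_le : (s.+2 <= b)%N).

(* The block occupies the coordinates [1..r] x [1..s] of this chart, and its
   boundary has coordinates in [0..r+1] x [0..s+1]. *)
Definition point (p q : nat) : vertex a b := (x0 + p%:R - 1, y0 + q%:R - 1).

Definition row_of (v : vertex a b) : nat := nat_of_ord (v.1 - x0 + 1).
Definition col_of (v : vertex a b) : nat := nat_of_ord (v.2 - y0 + 1).

Definition block : {set vertex a b} :=
  [set (x0 + p%:R, y0 + q%:R) | p : 'I_r, q : 'I_s].

Let a_gt1 : (1 < a)%N. Proof. by apply: leq_trans r_le. Qed.
Let b_gt1 : (1 < b)%N. Proof. by apply: leq_trans s_le. Qed.

(** Since [r.+2 <= a], the window does not wrap round the torus. *)
Lemma row_of_point p q : (p < r.+2)%N -> row_of (point p q) = p.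
Proof. by move=> pr; apply: Zp_shiftK => //; apply: leq_trans r_le. Qed.

Lemma col_of_point p q : (q < s.+2)%N -> col_of (point p q) = q.
Proof. by move=> qs; apply: Zp_shiftK => //; apply: leq_trans s_le. Qed.

Lemma pointK v : point (row_of v) (col_of v) = v.
Proof. by case: v => x y; congr (_, _); exact: Zp_unshiftK. Qed.

Lemma pointS p q : point p.+1 q.+1 = (x0 + p%:R, y0 + q%:R).
Proof. by rewrite /point -!natr1 !addrA !addrK. Qed.

Lemma point_blockP v :
  reflect (exists p q, [/\ (p < r)%N, (q < s)%N & v = point p.+1 q.+1]) (v \in block).
Proof.
apply: (iffP imset2P) => [[p q _ _ ->]|[p [q [pr qs ->]]]].
  by exists p, q; rewrite pointS.
by exists (Ordinal pr) (Ordinal qs); rewrite // pointS.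
Qed.

Lemma point_block p q : (p < r.+2)%N -> (q < s.+2)%N ->
  (point p q \in block) = [&& 0 < p, p <= r, 0 < q & q <= s]%N.
Proof.
move=> pr qs; apply/point_blockP/idP => [[p' [q' [p'r q's e]]]|].
  have -> : p = p'.+1.
    by rewrite -(@row_of_point p q) // e row_of_point // ltnS ltnW.
  have -> : q = q'.+1.
    by rewrite -(@col_of_point p q) // e col_of_point // ltnS ltnW.
  by rewrite p'r q's.
case: p q {pr qs} => [|p] [|q] //=; rewrite ?andbF // => /andP[pr qs].
by exists p, q.
Qed.

Lemma adj_point p q v :
  adj (point p.+1 q.+1) v =
  [|| v == point p.+2 q.+1, v == point p q.+1, v == point p.+1 q.+2
    | v == point p.+1 q].
Proof.
rewrite /adj /= /point.
have E n (z : 'Z_n) i : z + i.+1%:R - 1 = z + i%:R by rewrite -natr1 addrA addrK.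
by rewrite !E -!natr1 !addrA.
Qed.

Definition cell (k : nat) : vertex a b := point (k %/ s).+1 (k %% s).+1.

Lemma cellE p q : (q < s)%N -> cell (p * s + q) = point p.+1 q.+1.
Proof.
by move=> qs; rewrite /cell divnMDl // divn_small // addn0 modnMDl modn_small.
Qed.

Lemma cell_div k : (k < r * s)%N -> (k %/ s < r)%N.
Proof. by rewrite ltn_divLR. Qed.

Lemma cell_lt p q : (p < r)%N -> (q < s)%N -> (p * s + q < r * s)%N.
Proof.
move=> pr qs; apply: (@leq_trans (p.+1 * s)%N); last by rewrite leq_mul2r pr orbT.
by rewrite mulSn addnC ltn_add2r.
Qed.

Lemma cell_inj : {in gtn (r * s)%N &, injective cell}.
Proof.
move=> k l; rewrite !inE => kK lK e; rewrite (divn_eq k s) (divn_eq l s).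
have := congr1 row_of e; have := congr1 col_of e; rewrite /cell.
rewrite !col_of_point ?row_of_point ?ltnS ?(ltnW (ltn_pmod _ _)) //;
  do ?by rewrite ltnW ?cell_div.
by move=> [->] [->].
Qed.

Lemma mem_cells v : (v \in [seq cell l | l <- iota 0 (r * s)]) = (v \in block).
Proof.
apply/mapP/point_blockP => [[l]|[p [q [pr qs ->]]]].
  rewrite mem_iota /= add0n => lK ->; exists (l %/ s)%N, (l %% s)%N.
  by rewrite cell_div ?ltn_pmod.
by exists (p * s + q)%N; rewrite ?cellE // mem_iota cell_lt.
Qed.

Variable M : nat -> nat -> nat.
Hypothesis M_lt6 : forall p q, (M p q < 6)%N.

Definition paint : colouring a b := [ffun v => inord (M (row_of v) (col_of v))].

Lemma val_paint p q : (p < r.+2)%N -> (q < s.+2)%N ->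
  val (paint (point p q)) = M p q.
Proof. by move=> pr qs; rewrite ffunE row_of_point ?col_of_point //= inordK. Qed.

(** Each cell is tested against its upper and left neighbours; the lower and right ones are tested
    only in the last row and column, where they belong to the boundary. *)
Lemma notin_grid_bad hot (g : colouring a b) p q : (p < r)%N -> (q < s)%N ->
  (forall v, v \notin block -> g v = paint v) ->
  (val (g (cell (p * s + q))) \notin
     grid_bad r s M hot (p * s + q) (hist cell g (p * s + q))) =
  [&& g (point p.+1 q.+1) != g (point p q.+1),
      g (point p.+1 q.+1) != g (point p.+1 q),
      (p.+1 == r) ==> (g (point p.+1 q.+1) != g (point p.+2 q.+1)),
      (q.+1 == s) ==> (g (point p.+1 q.+1) != g (point p.+1 q.+2))
    & ((p == 0) && (q == 0))%N ==> (val (g (point 1 1)) \in hot)].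
Proof.
move=> pr qs out.
have dv : ((p * s + q) %/ s = p)%N by rewrite divnMDl // divn_small // addn0.
have md : ((p * s + q) %% s = q)%N by rewrite modnMDl modn_small.
have ring p' q' : (p' < r.+2)%N -> (q' < s.+2)%N ->
    ~~ [&& 0 < p', p' <= r, 0 < q' & q' <= s]%N -> M p' q' = val (g (point p' q')).
  by move=> p'r q's nb; rewrite out ?val_paint // point_block.
(* The cell above was coloured [s] steps earlier, hence position [s.-1] of the history; above the
   first row lies the boundary. *)
have up : (if p.+1 == 1%N then M 0%N q.+1
           else nth 0%N (hist cell g (p * s + q)) s.-1) = val (g (point p q.+1)).
  case: p pr {dv md} => [|p] pr /=; first by rewrite ring // ltnS ltnW.
  rewrite nth_hist; last by rewrite mulSn -addnA ltn_addr // prednK.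
  rewrite -cellE //; congr (val (g (cell _))).
  by move: s_gt0; rewrite mulSn; lia.
have left : (if q.+1 == 1%N then M p.+1 0%N
             else nth 0%N (hist cell g (p * s + q)) 0%N) = val (g (point p.+1 q)).
  case: q qs {dv md up} => [|q] qs /=; first by rewrite ring ?andbF // ltnS ltnW.
  by rewrite addnS nth_hist // subn0 /= cellE // ltnW.
rewrite /grid_bad dv md up left {1}cellE //.
rewrite !inE !negb_or !mem_cat !negb_or !val_eqE; congr [&& _, _, _, _ & _].
- by case: eqP => //= pE; rewrite inE -val_eqE -pE (ring p.+2 q.+1) //; lia.
- by case: eqP => //= qE; rewrite inE -val_eqE -qE (ring p.+1 q.+2) //; lia.
rewrite addn_eq0 muln_eq0 (gtn_eqF s_gt0) orbF.
case: ifP; last by [].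
move=> /andP[/eqP p0 /eqP q0].
by rewrite p0 q0 implyTb mem_filter mem_iota leq0n ltn_ord !andbT negbK.
Qed.

Lemma extensions_paint hot :
  extensions cell (grid_bad r s M hot) paint 0 (r * s) =
  [set g in heat_bath_support block paint | val (g (point 1 1)) \in hot].
Proof.
apply/setP => g; rewrite [RHS]inE [LHS]inE.
have -> : [forall v, (v \in [seq cell l | l <- iota 0 (r * s)]) || (g v == paint v)]
          = [forall v in ~: block, g v == paint v].
  apply: eq_forallb => v; rewrite mem_cells inE.
  by case: (v \in block).
case: (boolP [forall v in ~: block, g v == paint v]) => [/forall_inP out|nout] /=; last first.
  by apply/esym/negbTE/negP => /andP[+ _]; rewrite inE => /and3P[+ _ _]; apply/negP.
have {}out v : v \notin block -> g v = paint v by move=> vB; apply/eqP/out; rewrite inE.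
apply/allP/andP => [good|[/heat_bath_supportP[_ good] ghot] l].
  have cl p q : (p < r)%N -> (q < s)%N -> (p * s + q)%N \in iota 0 (r * s).
    by move=> pr qs; rewrite mem_iota cell_lt.
  have {}good p q : (p < r)%N -> (q < s)%N -> _ :=
    fun pr qs => elimT and5P (etrans (esym (notin_grid_bad hot pr qs out))
      (good _ (cl p q pr qs))).
  split.
    apply/heat_bath_supportP; split=> // u v /point_blockP[p [q [pr qs ->]]].
    have [up left /implyP down /implyP right _] := good p q pr qs.
    (* An edge going down or right within the block is tested at its other end, as an edge going up
       or left. *)
    rewrite adj_point => /or4P[] /eqP-> //.
      have [/eqP/down //|pr'] := eqVneq p.+1 r.
      have p1r : (p.+1 < r)%N by rewrite ltn_neqAle pr'.
      by have [up' _ _ _ _] := good p.+1 q p1r qs; rewrite eq_sym.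
    have [/eqP/right //|qs'] := eqVneq q.+1 s.
    have q1s : (q.+1 < s)%N by rewrite ltn_neqAle qs'.
    by have [_ left' _ _ _] := good p q.+1 pr q1s; rewrite eq_sym.
  by have [_ _ _ _] := good 0%N 0%N r_gt0 s_gt0.
rewrite mem_iota add0n => /= lK; rewrite (divn_eq l s).
have pr := cell_div lK; have qs : (l %% s < s)%N by rewrite ltn_pmod.
have inB : point (l %/ s).+1 (l %% s).+1 \in block.
  by apply/point_blockP; exists (l %/ s)%N, (l %% s)%N.
rewrite notin_grid_bad // !(good _ _ inB) ?implybT /=; do ?by rewrite adj_point eqxx ?orbT.
by rewrite ghot implybT.
Qed.

End Window.

Section Window.

Variables (a b r s : nat) (x0 : 'Z_a) (y0 : 'Z_b).
Hypotheses (r_gt0 : (0 < r)%N) (s_gt0 : (0 < s)%N).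
Hypotheses (r_le : (r.+2 <= a)%N) (s_le : (s.+2 <= b)%N).
Variable M : nat -> nat -> nat.
Hypothesis M_lt6 : forall p q, (M p q < 6)%N.

Lemma card_corner_colour hot :
  #|[set g in heat_bath_support (block r s x0 y0) (paint x0 y0 M)
      | val (g (point x0 y0 1 1)) \in hot]| = N.to_nat (grid_count r s M hot).
Proof.
rewrite -extensions_paint // (@card_extensions _ _ s (r * s)) //.
- exact: cell_inj.
- by move=> k h; exact: grid_bad_take.
Qed.

(** Declaring all six colours hot removes the restriction at the corner. *)
Lemma card_heat_bath_support :
  #|heat_bath_support (block r s x0 y0) (paint x0 y0 M)| =
  N.to_nat (grid_count r s M (iota 0 6)).
Proof.
rewrite -card_corner_colour; apply: eq_card => g.
by rewrite [RHS]inE mem_iota leq0n ltn_ord !andbT.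
Qed.

End Window.

(** * Couplings and influence *)

(** Pointwise, 1_A(x) - 1_A(y) <= 1_D(x, y); integrate against [mu]. *)
Lemma coupling_ge (R : realType) (T : finType) (p q : T -> R) mu
    (A : pred T) (D : pred (T * T)) :
  is_coupling p q mu -> (forall x y, A x -> ~~ A y -> D (x, y)) ->
  \sum_(x | A x) p x - \sum_(y | A y) q y <= \sum_(w | D w) mu w.
Proof.
case=> [[mu_ge0 _] margp margq] AD.
have -> : \sum_(x | A x) p x = \sum_(w | A w.1) mu w.
  under eq_bigr do rewrite -margp.
  by rewrite pair_big /=; apply: eq_big => -[x y] //=; rewrite andbT.
have -> : \sum_(y | A y) q y = \sum_(w | A w.2) mu w.
  under eq_bigr do rewrite -margq.
  by rewrite exchange_big pair_big /=; apply: eq_big => -[x y].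
rewrite [X in X - _]big_mkcond [X in _ - X]big_mkcond [leRHS]big_mkcond.
rewrite -sumrB; apply: ler_sum => -[x y] _ /=.
have [Ax|nAx] := boolP (A x); have [Ay|nAy] := boolP (A y);
  rewrite ?subr0 ?sub0r ?subrr; try by case: ifP.
  by rewrite AD.
by apply: (@le_trans _ _ 0); [rewrite oppr_le0 | case: ifP].
Qed.

Lemma sum_heat_bath (R : realType) (a b : nat) (B : {set vertex a b})
    (sigma : colouring a b) (A : pred (colouring a b)) :
  \sum_(g | A g) heat_bath R B sigma g =
  #|[set g in heat_bath_support B sigma | A g]|%:R / #|heat_bath_support B sigma|%:R.
Proof.
rewrite /heat_bath -big_mkcondr sumr_const mulr_natl; congr (_ *+ _).
by apply: eq_card => g; rewrite [RHS]inE [LHS]unfold_in /= andbC.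
Qed.

Definition Nr (R : realType) (n : N) : R := (N.to_nat n)%:R.

Lemma NrD (R : realType) m n : Nr R (m + n)%num = Nr R m + Nr R n.
Proof. by rewrite /Nr Nnat.N2Nat.inj_add natrD. Qed.
Lemma NrM (R : realType) m n : Nr R (m * n)%num = Nr R m * Nr R n.
Proof. by rewrite /Nr Nnat.N2Nat.inj_mul natrM. Qed.
Lemma Nr_le (R : realType) m n : N.leb m n -> Nr R m <= Nr R n.
Proof. by move=> /N.leb_le mn; rewrite ler_nat; lia. Qed.
Lemma Nr_gt0 (R : realType) n : N.ltb 0 n -> 0 < Nr R n.
Proof. by move=> /N.ltb_lt mn; rewrite ltr0n; lia. Qed.
(** Splitting off factors of 10 avoids a unary numeral of size one million. *)
Lemma Nr_million (R : realType) : Nr R 1000000 = 10 ^+ 6.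
Proof.
by rewrite (_ : 1000000 = 10 * (10 * (10 * (10 * (10 * 10)))))%num // !NrM !exprS mulr1.
Qed.

(** * From witnesses to lower bounds on the influence *)

Section Influence.

Variables (R : realType) (a b m r s : nat).
Hypotheses (r_gt0 : (0 < r)%N) (s_gt0 : (0 < s)%N).
Hypotheses (r_le : (r.+2 <= a)%N) (s_le : (s.+2 <= b)%N).

Lemma wcolour_lt6 w : in_window r s w -> forall p q, (wcolour w p q < 6)%N.
Proof.
case/and3P => _ _ /allP w6 p q; rewrite /wcolour.
(* Entries missing from the lists default to 0, which is a colour. *)
have [pw|pw] := ltnP p (size (wgrid w)); last by rewrite [nth [::] _ _]nth_default ?nth_nil.
have /allP rowp := w6 _ (mem_nth [::] pw).
have [qw|qw] := ltnP q (size (nth [::] (wgrid w) p)); last by rewrite nth_default.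
exact: rowp (mem_nth _ qw).
Qed.

Lemma wcolour'_lt6 w : in_window r s w -> forall p q, (wcolour' w p q < 6)%N.
Proof. by move=> ww p q; rewrite /wcolour'; case: ifP => // _; exact: wcolour_lt6. Qed.

Lemma rho_ge (x0 : 'Z_a) (y0 : 'Z_b) Psi w :
  (forall i sigma tau, (sigma, tau) \in agree_off i ->
     is_coupling (heat_bath R (block r s x0 y0) sigma)
       (heat_bath R (block r s x0 y0) tau) (Psi sigma tau)) ->
  in_window r s w -> wcheck r s w ->
  Nr R (wbound w) / 10 ^+ 6 <=
  rho Psi (point x0 y0 (wrow w) (wcol w)) (point x0 y0 1 1).
Proof.
move=> coupl ww /and3P[n_gt0 n'_gt0 /(Nr_le R)].
rewrite !(NrD, NrM) Nr_million => bound.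
set i := point _ _ (wrow w) _; set j := point _ _ 1 1.
pose st := (paint x0 y0 (wcolour w), paint x0 y0 (wcolour' w)).
have agree : st \in agree_off i.
  rewrite inE; apply/forallP => l; apply/implyP => li; rewrite /= !ffunE /wcolour'.
  case: andP => // -[/eqP rE /eqP cE].
  by rewrite /i -rE -cE pointK eqxx in li.
apply: le_trans (le_bigmax_cond _ _ agree).
pose A (g : colouring a b) := val (g j) \in whot w.
apply: le_trans (coupling_ge (A := A) (coupl _ _ _ agree) _); last first.
  by move=> x y Ax; apply: contraNneq => /= xy; rewrite /A -xy.
rewrite !sum_heat_bath !card_corner_colour ?card_heat_bath_support //;
  try exact: wcolour_lt6; try exact: wcolour'_lt6.
rewrite -!/(Nr R _).
have := Nr_gt0 R n_gt0; have := Nr_gt0 R n'_gt0; move: bound.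
set n := Nr R (grid_count _ _ (wcolour w) (iota 0 6)).
set n' := Nr R (grid_count _ _ (wcolour' w) (iota 0 6)).
set c := Nr R (grid_count _ _ (wcolour w) _); set c' := Nr R (grid_count _ _ (wcolour' w) _).
move: n n' c c' => n n' c c' bound n'0 n0.
(* Over the common denominator the claim becomes the inequality tested by [wcheck]. *)
have -> : c / n - c' / n' = (c * n' - c' * n) / (n * n').
  by field; rewrite !gt_eqF.
rewrite ler_pdivrMr ?exprn_gt0 // mulrAC ler_pdivlMr ?mulr_gt0 //.
by move: bound; set t := 10 ^+ 6; lra.
Qed.

Lemma rho_ge0 Psi (i j : vertex a b) : 0 <= rho Psi i j :> R.
Proof. exact: bigmax_ge_id. Qed.

Lemma influence_ge (Theta : 'I_m -> {set vertex a b})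
    (Psi : 'I_m -> colouring a b -> colouring a b -> colouring a b * colouring a b -> R)
    (ws : seq witness) (t : N) :
  \bigcup_(k < m) Theta k = [set: vertex a b] ->
  (forall k i sigma tau, (sigma, tau) \in agree_off i ->
     is_coupling (heat_bath R (Theta k) sigma) (heat_bath R (Theta k) tau)
       (Psi k sigma tau)) ->
  (forall k, is_subgrid r s (Theta k)) ->
  certificate r s ws t ->
  Nr R t / 10 ^+ 6 <= influence Theta Psi.
Proof.
move=> cover coupl sub /and4P[uniq_ws win ok /(Nr_le R) t_le].
apply: (@le_trans _ _ (Nr R (sumN [seq wbound w | w <- ws]) / 10 ^+ 6)).
  by rewrite ler_pM2r // invr_gt0 exprn_gt0.
move=> {t t_le}.
(* The cover provides at least one block; its corner will bound the maximum from below. *)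
have [k _] : exists k, (0, 0) \in Theta k.
  have: (0, 0) \in \bigcup_(k < m) Theta k by rewrite cover inE.
  by case/bigcupP => k; exists k.
have [x0 [y0 Tk]] := sub k.
have {}Tk : Theta k = block r s x0 y0 by [].
set j := point x0 y0 1 1.
have jT : j \in Theta k.
  by rewrite Tk; apply/point_blockP; exists 0%N, 0%N.
apply: (@le_trans _ _ (\sum_i rho (Psi k) i j)); last first.
  apply: (le_trans (le_bigmax_cond _ (fun j => \sum_i rho (Psi k) i j) jT)).
  exact: (le_bigmax_cond _ (fun k => \big[Order.max/0]_(j in Theta k) \sum_i rho (Psi k) i j)).
pose pos w := point x0 y0 (wrow w) (wcol w).
(* Window coordinates can be read back from torus vertices, so distinct coordinates give distinct
   vertices. *)
have uniq_pos : uniq (map pos ws).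
  apply: (@map_uniq _ _ (fun v => (row_of x0 v, col_of y0 v))).
  suff -> : [seq (row_of x0 v, col_of y0 v) | v <- map pos ws] =
            [seq (wrow w, wcol w) | w <- ws] by [].
  elim: (ws) win => //= w ws' IHws /andP[/and3P[wr wc _] /IHws->].
  by rewrite (row_of_point _ _ r_le) ?(col_of_point _ _ s_le).
(* Vertices without a witness contribute nonnegative terms, which are dropped. *)
apply: (@le_trans _ _ (\sum_(i <- map pos ws) rho (Psi k) i j)); last first.
  rewrite big_uniq //= [leRHS](bigID (mem (map pos ws))) /= lerDl.
  by apply: sumr_ge0 => i _; exact: rho_ge0.
rewrite big_map; elim: ws win ok {uniq_ws uniq_pos} => [|w ws IHws] /=.
  by rewrite big_nil /Nr mul0r.
case/andP=> ww /IHws{}IHws /andP[wok /IHws{}IHws].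
rewrite big_cons NrD mulrDl lerD //.
by apply: rho_ge => // i sigma tau agree; rewrite -Tk; apply: coupl agree.
Qed.

End Influence.

(** * Witnesses *)

(* Found by a randomised local search maximising the total variation distance
   of the marginals at the corner.  For square blocks, reflection in the
   diagonal fixes the corner and swaps the witnesses in pairs. *)
Definition witnesses_2_2 : seq witness :=
  flatten [seq [:: w; wtranspose w] | w <- [::
      Witness 0 1 [:: 1; 2; 4; 5] 379844%num
      [:: [:: 0; 0; 0; 0];
          [:: 3; 0; 0; 1];
          [:: 0; 0; 0; 2];
          [:: 0; 3; 4; 0]];
      Witness 0 2 [:: 0] 107142%num
      [:: [:: 0; 2; 0; 0];
          [:: 3; 0; 0; 2];
          [:: 1; 0; 0; 1];
          [:: 0; 0; 0; 0]];
      Witness 1 3 [:: 0] 107142%num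
      [:: [:: 0; 5; 5; 0];
          [:: 2; 0; 0; 0];
          [:: 0; 0; 0; 1];
          [:: 0; 1; 0; 0]];
      Witness 2 3 [:: 1] 50505%num
      [:: [:: 0; 5; 4; 0];
          [:: 4; 0; 0; 5];
          [:: 4; 0; 0; 0];
          [:: 0; 5; 4; 0]]]].

(** There is no diagonal symmetry here; five of the ten boundary vertices suffice. *)
Definition witnesses_2_3 : seq witness :=
  [:: Witness 0 1 [:: 1; 2; 3; 5] 367191%num
      [:: [:: 0; 0; 0; 2; 0];
          [:: 4; 0; 0; 0; 5];
          [:: 0; 0; 0; 0; 4];
          [:: 0; 4; 3; 1; 0]];
      Witness 1 0 [:: 1; 2; 3; 4] 367191%num
      [:: [:: 0; 5; 0; 4; 0];
          [:: 0; 0; 0; 0; 3];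
          [:: 5; 0; 0; 0; 5];
          [:: 0; 0; 2; 1; 0]];
      Witness 2 0 [:: 0; 3; 4] 99710%num
      [:: [:: 0; 5; 1; 3; 0];
          [:: 2; 0; 0; 0; 4];
          [:: 0; 0; 0; 0; 2];
          [:: 0; 5; 1; 3; 0]];
      Witness 3 1 [:: 0] 99710%num
      [:: [:: 0; 5; 0; 2; 0];
          [:: 4; 0; 0; 0; 3];
          [:: 4; 0; 0; 0; 2];
          [:: 0; 0; 0; 5; 0]];
      Witness 0 2 [:: 0] 97283%num
      [:: [:: 0; 2; 0; 0; 0];
          [:: 4; 0; 0; 0; 1];
          [:: 0; 0; 0; 0; 2];
          [:: 0; 2; 0; 4; 0]]].

Definition witnesses_3_3 : seq witness :=
  flatten [seq [:: w; wtranspose w] | w <- [::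
      Witness 0 1 [:: 1] 353759%num
      [:: [:: 0; 0; 1; 5; 0];
          [:: 4; 0; 0; 0; 2];
          [:: 1; 0; 0; 0; 0];
          [:: 3; 0; 0; 0; 5];
          [:: 0; 2; 4; 3; 0]];
      Witness 0 2 [:: 0] 83691%num
      [:: [:: 0; 5; 0; 1; 0];
          [:: 2; 0; 0; 0; 0];
          [:: 0; 0; 0; 0; 2];
          [:: 0; 0; 0; 0; 1];
          [:: 0; 4; 5; 0; 0]];
      Witness 0 3 [:: 1; 3; 5] 24514%num
      [:: [:: 0; 2; 2; 0; 0];
          [:: 4; 0; 0; 0; 2];
          [:: 0; 0; 0; 0; 0];
          [:: 0; 0; 0; 0; 0];
          [:: 0; 3; 4; 4; 0]];
      Witness 1 4 [:: 1; 3; 4] 24514%num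
      [:: [:: 0; 2; 2; 2; 0];
          [:: 5; 0; 0; 0; 0];
          [:: 0; 0; 0; 0; 0];
          [:: 4; 0; 0; 0; 0];
          [:: 0; 0; 5; 5; 0]];
      Witness 2 4 [:: 0; 3; 4] 13839%num
      [:: [:: 0; 2; 2; 3; 0];
          [:: 5; 0; 0; 0; 2];
          [:: 5; 0; 0; 0; 0];
          [:: 1; 0; 0; 0; 1];
          [:: 0; 4; 1; 0; 0]];
      Witness 3 4 [:: 1] 7140%num
      [:: [:: 0; 4; 5; 2; 0];
          [:: 5; 0; 0; 0; 5];
          [:: 4; 0; 0; 0; 2];
          [:: 4; 0; 0; 0; 0];
          [:: 0; 2; 2; 2; 0]]]].

(** All eight boundary vertices are used; the bounds add up to 1.289266. *)
Lemma certified_2_2 : certificate 2 2 witnesses_2_2 (1286 * 1000).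
Proof. by vm_compute. Qed.

(** The five bounds add up to 1.031085. *)
Lemma certified_2_3 : certificate 2 3 witnesses_2_3 (1028 * 1000).
Proof. by vm_compute. Qed.

(** All twelve boundary vertices are used; the bounds add up to 1.014914. *)
Lemma certified_3_3 : certificate 3 3 witnesses_3_3 (10148 * 100).
Proof. by vm_compute. Qed.

Theorem mainTheorem5 (R : realType) (a b : nat)
    (ha : (5 <= a)%N) (hb : (5 <= b)%N)
    (m : nat) (Theta : 'I_m -> {set vertex a b})
    (Theta_cover : \bigcup_(k < m) Theta k = [set: vertex a b])
    (Psi : 'I_m -> colouring a b -> colouring a b ->
           colouring a b * colouring a b -> R)
    (Psi_coupling :
       forall (k : 'I_m) (i : vertex a b) (sigma tau : colouring a b),
         (sigma, tau) \in agree_off i ->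
         is_coupling (heat_bath R (Theta k) sigma) (heat_bath R (Theta k) tau)
           (Psi k sigma tau)) :
  [/\ (forall k, is_subgrid 2 2 (Theta k)) ->
        1 < (1 + 286 / 10 ^+ 3 : R) <= influence Theta Psi,
      (forall k, is_subgrid 2 3 (Theta k)) ->
        1 < (1 + 28 / 10 ^+ 3 : R) <= influence Theta Psi
    & (forall k, is_subgrid 3 3 (Theta k)) ->
        1 < (1 + 148 / 10 ^+ 4 : R) <= influence Theta Psi].
Proof.
(* The largest window, around a 3 x 3 block, is 5 x 5 and fits because a, b >= 5. *)
have ra r : (r.+2 <= 5 -> r.+2 <= a)%N by move=> r5; apply: leq_trans ha.
have sb s : (s.+2 <= 5 -> s.+2 <= b)%N by move=> s5; apply: leq_trans hb.
have Nr_thousand k : Nr R (k * 1000) = Nr R k * 10 ^+ 3.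
  by rewrite (_ : 1000 = 10 * (10 * 10))%num // !NrM !exprS mulr1.
have Nr_hundred k : Nr R (k * 100) = Nr R k * 10 ^+ 2.
  by rewrite (_ : 100 = 10 * 10)%num // !NrM.
split=> sub; rewrite ltrDl divr_gt0 ?exprn_gt0 ?ltr0n //=.
- have := @influence_ge R a b m 2 2 isT isT (ra 2 isT) (sb 2 isT) _ _ _ _
    Theta_cover Psi_coupling sub certified_2_2.
  rewrite Nr_thousand (_ : Nr R 1286 = 1286) //; apply: le_trans.
  by lra.
- have := @influence_ge R a b m 2 3 isT isT (ra 2 isT) (sb 3 isT) _ _ _ _
    Theta_cover Psi_coupling sub certified_2_3.
  rewrite Nr_thousand (_ : Nr R 1028 = 1028) //; apply: le_trans.
  by lra.
have := @influence_ge R a b m 3 3 isT isT (ra 3 isT) (sb 3 isT) _ _ _ _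
    Theta_cover Psi_coupling sub certified_3_3.
rewrite Nr_hundred (_ : Nr R 10148 = 10148) //; apply: le_trans.
by lra.
Qed.
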